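(* Let $G=H\times A_5$, where $H$ is a cyclic group of order $n=\prod_{i=1}^{m}p_i^{a_i}$, with $p_1,\dots,p_m$ distinct primes greater than $5$ and $a_1,\dots,a_m\ge 1$. Then $$\mathcal{V}(G)=\frac{32+\omega(n)}{59\cdot\tau(n)}.$$
   Context: For a finite group $G$, $L(G)$ denotes the set of all subgroups of $G$ (including the trivial subgroup and $G$ itself), $s(G)$ denotes the number of subgroups of $G$ that are simple groups (the trivial group is not simple; cyclic groups of prime order are simple), and $\mathcal{V}(G)=s(G)/|L(G)|$. Subgroups are counted as subsets of $G$. $A_5$ is the alternating group on 5 letters, $\omega(n)$ is the number of distinct prime factors of $n$, and $\tau(n)$ is the number of positive divisors of $n$. *)

(* Defs.v *)
From HB Require Import structures.
From mathcomp Require Import all_boot all_order all_algebra all_fingroup all_solvable.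
Set Implicit Arguments.
Unset Strict Implicit.
Unset Printing Implicit Defensive.

Import GRing.Theory.
Local Open Scope ring_scope.

(* The set L(G) of all subgroups of G is the library's [subgroups G]; the
   library's [simple] excludes the trivial group (see [simpleP]). *)
Definition simple_subgroups (gT : finGroupType) (G : {group gT}) :
    {set {group gT}} :=
  [set K in subgroups G | simple K].

Definition simple_ratio (gT : finGroupType) (G : {group gT}) : rat :=
  #|simple_subgroups G|%:R / #|subgroups G|%:R.

Definition omega (n : nat) : nat := size (primes n).

Definition tau (n : nat) : nat := size (divisors n).

(* Main.v *)
(* Since |H| and |A_5| = 60 are coprime, every subgroup of H x A_5 is a product
   K x L, and it is simple exactly when one factor is trivial and the other one
   simple.  Subgroups of the cyclic group H correspond to the divisors of n, the
   simple ones to its prime divisors.  The subgroups of A_5 are enumerated by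
   computation: a list of 59 generating lists contains the trivial subgroup and
   is stable under adjoining one element, hence is complete.  By Burnside's
   p^a q^b theorem a proper subgroup of A_5 is solvable, so it is simple only if
   its order is prime. *)

Require Import Defs.
From HB Require Import structures.
From mathcomp Require Import all_boot all_order all_algebra all_fingroup all_solvable.
From mathcomp Require Import integral_char.

Set Implicit Arguments.
Unset Strict Implicit.
Unset Printing Implicit Defensive.

(** * Groups of prime order and counting of finite sets *)

Lemma prime_simple (gT : finGroupType) (G : {group gT}) : prime #|G| -> simple G.
Proof.
move=> prG; apply/simpleP; split=> [|H /andP[sHG _]].
  by apply: contraTneq prG => ->; rewrite cards1.
have /primeP[_ /(_ _ (cardSg sHG))/orP[/eqP oH | /eqP oH]] := prG.
  by left; apply: card1_trivg.
by right; apply/eqP; rewrite eqEcard sHG oH leqnn.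
Qed.

Lemma card_set_filter (T : finType) (A : {set T}) (s : seq T) (P : pred T) :
  A =i s -> uniq s -> #|[set x in A | P x]| = count P s.
Proof.
move=> eqAs s_uniq; rewrite -size_filter -(card_uniqP (filter_uniq P s_uniq)).
by apply: eq_card => x; rewrite inE mem_filter eqAs andbC.
Qed.

Lemma card_count_enum (I : eqType) (T : finType) (A : {set T}) (f : I -> T) (s : seq I) :
    uniq s -> {in s &, injective f} -> {subset A <= [seq f i | i <- s]} ->
  #|A| = count (fun i => f i \in A) s.
Proof.
move=> s_uniq f_inj sAs; rewrite -size_filter -(size_map f).
have uniq_fs: uniq [seq f i | i <- s & f i \in A].
  rewrite map_inj_in_uniq ?filter_uniq // => i j.
  by rewrite !mem_filter => /andP[_ s_i] /andP[_ s_j]; apply: f_inj.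
rewrite -(card_uniqP uniq_fs); apply: eq_card => x; apply/idP/mapP=> [Ax | [i]].
  by have /mapP[i s_i def_x] := sAs x Ax; exists i; rewrite // mem_filter -def_x Ax.
by rewrite mem_filter => /andP[Ai _] ->.
Qed.

Section SubgroupCounts.

Local Open Scope group_scope.

(** Taking images under an injective morphism is injective on subgroups, which gives one inequality;
    the symmetry of isomorphism gives the other. *)
Lemma isog_card_subgroups (gT rT : finGroupType) (G : {group gT}) (H : {group rT})
    (P : pred {group gT}) (Q : pred {group rT}) :
    G \isog H -> (forall (K : {group gT}) (L : {group rT}), K \isog L -> P K = Q L) ->
  #|[set K in subgroups G | P K]| = #|[set L in subgroups H | Q L]|.
Proof.
move=> isoGH PQ; wlog suffices le: gT rT G H P Q isoGH PQ /
    (#|[set K in subgroups G | P K]| <= #|[set L in subgroups H | Q L]|)%N.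
  apply/eqP; rewrite eqn_leq !le // 1?isog_sym // => L K isoLK.
  by rewrite (PQ K L) // isog_sym.
have [f injf <-] := isogP isoGH.
rewrite -(@card_in_imset _ _ (fun K : {group gT} => f @* K)%G); last first.
  move=> K L; rewrite !inE => /andP[sKG _] /andP[sLG _] /(congr1 val) /= eqKL.
  exact/group_inj/(injm_morphim_inj injf sKG sLG).
apply/subset_leq_card/subsetP=> _ /imsetP[K /[!inE] /andP[sKG PK] ->].
by rewrite morphimS //= -(PQ K) // sub_isog.
Qed.

Lemma simple1 (gT : finGroupType) : simple [1 gT] = false.
Proof. by apply/simpleP=> -[/eqP]. Qed.

(** * Subgroups of a direct product of coprime orders *)

Section Product.

Variables gT1 gT2 : finGroupType.
Implicit Types (M : {group gT1 * gT2}) (G K : {group gT1}) (H L : {group gT2}).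

Lemma subgroup_setX_coprime G H M :
    coprime #|G| #|H| -> M \subset setX G H ->
  M :=: setX (fst @* M) (snd @* M).
Proof.
move=> coG sMG; apply/eqP; rewrite eqEsubset; apply/andP; split.
  apply/subsetP=> -[x y] Mxy.
  by rewrite inE /= -[x]/((x, y).1) -{2}[y]/((x, y).2) !mem_morphim ?inE.
have expX (u : gT1 * gT2) k : u ^+ k = (u.1 ^+ k, u.2 ^+ k).
  by elim: k => [|k IHk]; rewrite ?expgS ?IHk.
apply/subsetP=> -[x y] /setXP[/morphimP[u _ Ku ->] /morphimP[v _ Kv ->]] /=.
have /setXP[Gu1 Gu2] : (u.1, u.2) \in setX G H by rewrite -surjective_pairing (subsetP sMG).
have /setXP[Gv1 Gv2] : (v.1, v.2) \in setX G H by rewrite -surjective_pairing (subsetP sMG).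
(* Chinese remainders: [u ^+ c] is [(u.1, 1)] and [v ^+ d] is [(1, v.2)], so [M] contains the
   product of its two projections. *)
set c := chinese #|G| #|H| 1 0; set d := chinese #|G| #|H| 0 1.
have exp_mod (T : finGroupType) (D : {group T}) z k l :
    z \in D -> k = l %[mod #|D|] -> z ^+ k = z ^+ l.
  by move=> Dz eq_kl; rewrite -(expg_mod k (expg_cardG Dz)) eq_kl (expg_mod _ (expg_cardG Dz)).
have ->: (u.1, v.2) = u ^+ c * v ^+ d.
  rewrite !expX; congr (_, _) => /=.
    rewrite (exp_mod _ _ _ _ _ Gu1 (chinese_modl coG 1 0)).
    by rewrite (exp_mod _ _ _ _ _ Gv1 (chinese_modl coG 0 1)) mulg1.
  rewrite (exp_mod _ _ _ _ _ Gu2 (chinese_modr coG 1 0)).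
  by rewrite (exp_mod _ _ _ _ _ Gv2 (chinese_modr coG 0 1)) mul1g.
by rewrite groupM ?groupX.
Qed.

(** The pair of projections inverts the map sending a pair of subgroups to its product. The
    predicate [P] lets one bijection serve both the total and the simple count. *)
Lemma card_subgroups_setX (P : pred {group gT1 * gT2}) G H :
    coprime #|G| #|H| ->
  #|[set M in subgroups (setX G H) | P M]| =
    #|[set u in setX (subgroups G) (subgroups H) | P (setX_group u.1 u.2)]|.
Proof.
move=> coG; symmetry.
rewrite -(@card_in_imset _ _ (fun u => setX_group u.1 u.2)); last first.
  move=> [K L] [K' L'] _ _ /(congr1 val) /= eqKL.
  congr (_, _); apply: group_inj.
    by rewrite -(morphim_fstX K L) eqKL morphim_fstX.
  by rewrite -(morphim_sndX K L) eqKL morphim_sndX.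
apply: eq_card => M; rewrite inE; apply/imsetP/andP.
  case=> -[K L]; rewrite !inE /= => /andP[/andP[sK sL] PK] ->; split=> //.
  by rewrite ?inE setXS.
case; rewrite inE => sMG PK.
have defM: M = setX_group (fst @* M) (snd @* M).
  exact/group_inj/(subgroup_setX_coprime coG).
exists ((fst @* M)%G, (snd @* M)%G) => //=; rewrite !inE /= -defM PK andbT.
by rewrite -{1}(morphim_fstX G H) -{2}(morphim_sndX G H) !morphimS.
Qed.

Lemma simple_setX K L :
  simple (setX K L) = (K :==: 1) && simple L || simple K && (L :==: 1).
Proof.
have [-> /= | ntK] := eqVneq (K :> {set _}) 1.
  by rewrite simple1 orbF -(isog_simple (isog_set1X gT1 L)).
have [-> /= | ntL] := eqVneq (L :> {set _}) 1.
  by rewrite andbT -(isog_simple (isog_setX1 gT2 K)).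
(* With both factors nontrivial, [setX K 1] is a normal subgroup that is neither trivial nor
   everything. *)
rewrite andbF; apply/simpleP=> -[_ /(_ (setX_group K 1))[] ].
- by have [] := dprod_normal2 (setX_dprod K L).
- move/(congr1 (fun A => fst @* A)); rewrite /= morphim_fstX => K_1.
  by rewrite K_1 morphim1 eqxx in ntK.
move/(congr1 (fun A => snd @* A)); rewrite /= !morphim_sndX => L_1.
by rewrite -L_1 eqxx in ntL.
Qed.

Lemma card_simple_subgroups_setX G H :
    coprime #|G| #|H| ->
  #|simple_subgroups (setX_group G H)| =
    (#|simple_subgroups G| + #|simple_subgroups H|)%N.
Proof.
move=> coG; rewrite /simple_subgroups (card_subgroups_setX (fun M => simple M)) //.
(* The two families of simple subgroups are disjoint because the trivial group is not simple. *)
pose A := setX (simple_subgroups G) [set 1%G : {group gT2}].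
pose B := setX [set 1%G : {group gT1}] (simple_subgroups H).
rewrite [LHS](_ : _ = #|A :|: B|); last first.
  have eq1G (T : finGroupType) (D : {group T}) : (D == 1%G) = (D :==: 1).
    by apply/eqP/eqP=> [-> | /group_inj].
  apply: eq_card => -[K L]; rewrite !inE /= simple_setX !eq1G.
  have [-> | _] := eqVneq (K :> {set _}) 1.
    by rewrite simple1 sub1G orbF.
  have [-> | _] := eqVneq (L :> {set _}) 1; first by rewrite sub1G !andbT orbF.
  by rewrite !andbF.
rewrite cardsU !cardsX !cards1 muln1 mul1n [A :&: B](_ : _ = set0) ?cards0 ?subn0 //.
apply/setP=> -[K L]; rewrite !inE /=; apply/negP=> /andP[/andP[/andP[_ sK] _] /andP[/eqP K_1 _]].
by rewrite K_1 simple1 in sK.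
Qed.

End Product.

(** * Subgroups of a cyclic group *)

Section Cyclic.

Variables (gT : finGroupType) (H : {group gT}).
Hypothesis cycH : cyclic H.

(** In a cyclic group the order is a bijection from subgroups onto divisors. *)
Lemma card_cyclic_subgroups (P : pred nat) :
  #|[set K in subgroups H | P #|K|]| = count P (divisors #|H|).
Proof.
rewrite -size_filter cardE -(size_map (fun K : {group gT} => #|K|)).
apply/perm_size/uniq_perm.
- rewrite map_inj_in_uniq ?enum_uniq // => K L; rewrite !mem_enum !inE.
  move=> /andP[sKH _] /andP[sLH _] /eqP; rewrite -(eq_subG_cyclic cycH sKH sLH).
  by move/eqP/group_inj.
- by rewrite filter_uniq ?divisors_uniq.
move=> d; rewrite mem_filter -dvdn_divisors //; apply/mapP/andP.
  by case=> K; rewrite mem_enum !inE => /andP[sKH PK] ->; rewrite PK cardSg.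
case=> Pd d_dv; have /cyclicP[x defH] := cycH.
have d_dvx: d %| #[x] by rewrite /order -defH.
have /setP/(_ <[x ^+ (#[x] %/ d)]>%G) := cycle_sub_group d_dvx.
rewrite !inE eqxx -defH => /andP[sKH /eqP oK].
by exists <[x ^+ (#[x] %/ d)]>%G; rewrite ?mem_enum ?inE ?sKH ?oK.
Qed.

Lemma card_subgroups_cyclic : #|subgroups H| = tau #|H|.
Proof.
rewrite /tau -(count_predT (divisors _)) -card_cyclic_subgroups.
by apply: eq_card => K; rewrite !inE andbT.
Qed.

Lemma card_simple_subgroups_cyclic : #|simple_subgroups H| = omega #|H|.
Proof.
transitivity #|[set K in subgroups H | prime #|K|]|.
  apply: eq_card => K; rewrite !inE; apply: andb_id2l => sKH.
  apply/idP/idP; last exact: prime_simple.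
  by apply: simple_sol_prime; apply/abelian_sol/(abelianS sKH)/cyclic_abelian.
rewrite card_cyclic_subgroups -size_filter; apply/perm_size/uniq_perm.
- by rewrite filter_uniq ?divisors_uniq.
- exact: primes_uniq.
by move=> d; rewrite mem_filter mem_primes -dvdn_divisors // cardG_gt0.
Qed.

End Cyclic.
End SubgroupCounts.

(** * Elements of A_5 as lists of values *)

Section AltFive.
Local Open Scope group_scope.
Local Open Scope nat_scope.

(** Lists of values are plain data on which the enumeration can be evaluated. *)
Definition code (s : {perm 'I_5}) : seq nat := [seq nat_of_ord (s (inord i)) | i <- iota 0 5].

Definition code_mul (c d : seq nat) : seq nat := [seq nth 0 d i | i <- c].

Definition code_tperm (i j : nat) : seq nat :=
  [seq if k == i then j else if k == j then i else k | k <- iota 0 5].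

Lemma nth_code s (i : 'I_5) : nth 0 (code s) i = s i.
Proof. by rewrite (nth_map 0) ?size_iota // nth_iota // add0n inord_val. Qed.

Lemma code_inj : injective code.
Proof. by move=> s t eq_st; apply/permP=> i; apply: ord_inj; rewrite -!nth_code eq_st. Qed.

Lemma codeM s t : code (s * t)%g = code_mul (code s) (code t).
Proof.
rewrite /code_mul -map_comp; apply: eq_map => i /=.
by rewrite nth_code permM.
Qed.

Lemma code1 : code 1%g = iota 0 5.
Proof.
rewrite /code -[RHS]map_id; apply/eq_in_map=> i; rewrite mem_iota => /andP[_ lt_i].
by rewrite perm1 /= inordK.
Qed.

Lemma code_tpermE i j : i < 5 -> j < 5 ->
  code (tperm (inord i) (inord j)) = code_tperm i j.
Proof.
move=> lt_i lt_j; apply/eq_in_map=> k; rewrite mem_iota => /andP[_ lt_k].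
rewrite permE /= -!(inj_eq (@ord_inj 5)) /= !inordK //.
by case: ifP => _; [|case: ifP => _]; rewrite inordK.
Qed.

(** Three 3-cycles through 0 and 1, which generate A_5. *)
Definition cycle3_codes : seq (seq nat) :=
  [seq code_mul (code_tperm 0 1) (code_tperm 0 k) | k <- iota 2 3].

(* The diameter of A_5 for these generators is at most 6. *)
Definition codes : seq (seq nat) := Eval vm_compute in
  iter 6 (fun s => undup (s ++ [seq code_mul c d | c <- s, d <- cycle3_codes]))
       [:: iota 0 5].

Definition rmul_index (d : seq nat) : seq nat :=
  [seq index (code_mul c d) codes | c <- codes].

Definition rmul_table : seq (seq nat) :=
  Eval vm_compute in [seq rmul_index d | d <- codes].

(** The table has one row per right factor, so a generator selects a row. The default 60 is not a
    valid index. *)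
Definition rmul (i g : nat) : nat := nth 60 (nth [::] rmul_table g) i.

Definition id_index : nat := index (iota 0 5) codes.

Lemma mem_iota60 i : (i \in iota 0 60) = (i < 60).
Proof. by rewrite mem_iota. Qed.

Lemma card_Alt5 : #|'Alt_('I_5)| = 60.
Proof. by apply: double_inj; rewrite -mul2n card_Alt card_ord. Qed.

Lemma codes_sub_Alt c : c \in codes -> exists2 s, s \in 'Alt_('I_5) & code s = c.
Proof.
have cycle3P d : d \in cycle3_codes -> exists2 s, s \in 'Alt_('I_5) & code s = d.
  case/mapP=> k; rewrite mem_iota => /andP[lt1k ltk5] ->.
  exists (tperm (inord 0) (inord 1) * tperm (inord 0) (inord k))%g.
    rewrite Alt_even odd_permM !odd_tperm -!(inj_eq (@ord_inj 5)) /= !inordK //.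
    by case: k lt1k {ltk5}.
  by rewrite codeM !code_tpermE.
have ->: codes = iter 6 (fun s => undup (s ++
    [seq code_mul c d | c <- s, d <- cycle3_codes])) [:: iota 0 5] by vm_compute.
elim: 6 c => [|n IHn] c; first by rewrite inE => /eqP->; exists 1%g; rewrite ?code1.
rewrite iterS mem_undup mem_cat => /orP[/IHn //|].
case/allpairsP=> -[c1 d] /= [/IHn[s As <-] /cycle3P[t At <-] ->].
by exists (s * t)%g; rewrite ?groupM ?codeM.
Qed.

Lemma uniq_codes : uniq codes. Proof. by vm_compute. Qed.

(** The 60 distinct entries of [codes] all encode elements of A_5, which has only 60 elements, so
    none is missed. *)
Lemma code_in_codes s : s \in 'Alt_('I_5) -> code s \in codes.
Proof.
move=> As; pose r := [seq code t | t <- enum 'Alt_('I_5)].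
have sub_r : {subset codes <= r}.
  by move=> c /codes_sub_Alt[t At <-]; rewrite map_f ?mem_enum.
have [|_ ->] := uniq_min_size uniq_codes sub_r.
  by rewrite size_map -cardE card_Alt5.
by rewrite map_f ?mem_enum.
Qed.

(** * Numbering of A_5 by the indices below 60 *)

Definition idx (s : {perm 'I_5}) : nat := index (code s) codes.

(** Inverse of [idx] on indices below 60; beyond them the empty list is no code and the value is
    1. *)
Definition elt (i : nat) : {perm 'I_5} :=
  odflt 1%g [pick s in 'Alt_('I_5) | code s == nth [::] codes i].

Lemma eltP i : i < 60 -> elt i \in 'Alt_('I_5) /\ code (elt i) = nth [::] codes i.
Proof.
move=> lt_i; rewrite /elt; case: pickP => [s /andP[-> /eqP->] // | none].
have [s As def_c] := codes_sub_Alt (@mem_nth _ [::] codes i lt_i).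
by have := none s; rewrite As def_c eqxx.
Qed.

Lemma elt_Alt i : i < 60 -> elt i \in 'Alt_('I_5).
Proof. by case/eltP. Qed.

Lemma idx_lt s : s \in 'Alt_('I_5) -> idx s < 60.
Proof. by move/code_in_codes; rewrite -index_mem. Qed.

Lemma idxK s : s \in 'Alt_('I_5) -> elt (idx s) = s.
Proof.
by move=> As; apply: code_inj; case: (eltP (idx_lt As)) => _ ->; rewrite nth_index ?code_in_codes.
Qed.

Lemma eltK i : i < 60 -> idx (elt i) = i.
Proof.
by move=> lt_i; rewrite /idx; case: (eltP lt_i) => _ ->; rewrite index_uniq // uniq_codes.
Qed.

Lemma rmulE i g : i < 60 -> g < 60 -> rmul i g = idx (elt i * elt g).
Proof.
move=> lt_i lt_g; rewrite /rmul.
have ->: rmul_table = [seq rmul_index d | d <- codes] by vm_compute.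
rewrite (nth_map [::]) // (nth_map [::]) // /idx codeM.
by case: (eltP lt_i) => _ ->; case: (eltP lt_g) => _ ->.
Qed.

Lemma rmul_lt i g : i < 60 -> g < 60 -> rmul i g < 60.
Proof. by move=> lt_i lt_g; rewrite rmulE // idx_lt ?groupM ?elt_Alt. Qed.

Lemma elt_rmul i g : i < 60 -> g < 60 -> elt (rmul i g) = (elt i * elt g)%g.
Proof. by move=> lt_i lt_g; rewrite rmulE // idxK ?groupM ?elt_Alt. Qed.

Lemma elt_id : elt id_index = 1%g.
Proof. by rewrite /id_index -code1 idxK. Qed.

(* Depth-first search on the Cayley graph; [gs] lists generators, [v] marks the
   indices already visited (indices beyond 59 count as visited), and [n] bounds
   the depth. *)
Fixpoint visit (n : nat) (gs : seq nat) (v : bitseq) (i : nat) : bitseq :=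
  if n is n'.+1 then
    if nth true v i then v
    else foldl (fun v g => visit n' gs v (rmul i g)) (set_nth false v i true) gs
  else v.

(** Each nested call marks a new index, so depth 61 never cuts the search short. *)
Definition gen_mask (gs : seq nat) : bitseq := visit 61 gs (nseq 60 false) id_index.

(** * Generated subgroups and their bit masks *)

Definition gen_group (gs : seq nat) : {group {perm 'I_5}} :=
  <<[set s in [seq elt g | g <- gs]]>>%G.

Definition group_mask (K : {group {perm 'I_5}}) : bitseq :=
  mkseq (fun i => elt i \in K) 60.

Lemma mem_gen_group gs g : g \in gs -> elt g \in gen_group gs.
Proof. by move=> gs_g; rewrite mem_gen // inE map_f. Qed.

Lemma gen_group_subG gs (K : {group {perm 'I_5}}) :
  (gen_group gs \subset K) = all (fun g => elt g \in K) gs.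
Proof.
rewrite gen_subG; apply/subsetP/allP => [sub g gs_g | sub s]; last first.
  by rewrite inE => /mapP[g /sub Kg ->].
by apply: sub; rewrite inE map_f.
Qed.

(** Adjoining an element thus depends only on the group generated by the rest, so that generating
    lists can be exchanged in [subgroups_Alt5]. *)
Lemma gen_group_cons x gs : gen_group (x :: gs) = <<elt x |: gen_group gs>>%G.
Proof.
apply/group_inj/eqP; rewrite eqEsubset gen_group_subG; apply/andP; split.
  apply/allP=> g; rewrite inE => /predU1P[-> | gs_g]; first by rewrite mem_gen ?setU11.
  by rewrite mem_gen // in_setU1 mem_gen_group ?orbT.
have Gx := @mem_gen_group (x :: gs) x (mem_head x gs).
rewrite /= gen_subG subUset sub1set Gx gen_group_subG.
by apply/allP=> g gs_g; apply: (@mem_gen_group (x :: gs)); rewrite inE gs_g orbT.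
Qed.

Lemma visit_sound gs n v i j : all (fun g => g < 60) gs ->
    i < 60 -> elt i \in gen_group gs -> nth false (visit n gs v i) j ->
  nth false v j \/ j < 60 /\ elt j \in gen_group gs.
Proof.
move=> gs_lt; elim: n v i j => [|n IHn] v i j lt_i Gi /=; first by left.
case: ifP => _; first by left.
set w := set_nth _ _ _ _ => vj.
suffices: nth false w j \/ j < 60 /\ elt j \in gen_group gs.
  case=> [|Gj]; last by right.
  by rewrite nth_set_nth /=; case: eqP => [-> | _]; [right | left].
have sub: {subset gs <= gs} by [].
(* Only the list being folded shrinks; the recursive calls keep the full [gs], and [sub] records
   that the remaining entries are generators. *)
elim: {1 4}gs sub w vj => [|g s IHs] sub w /=; first by left.
have /sub gs_g := mem_head g s; have lt_g := allP gs_lt g gs_g.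
have sub_s: {subset s <= gs} by move=> y s_y; rewrite sub // inE s_y orbT.
case/(IHs sub_s) => [wj | Gj]; last by right.
apply: IHn wj; first exact: rmul_lt.
rewrite elt_rmul //; exact: groupM Gi (mem_gen_group gs_g).
Qed.

Lemma gen_mask_sound gs j : all (fun g => g < 60) gs ->
  nth false (gen_mask gs) j -> j < 60 /\ elt j \in gen_group gs.
Proof.
move=> gs_lt /visit_sound[] //; first by rewrite elt_id.
by rewrite nth_nseq if_same.
Qed.

Definition rmul_closed (gs : seq nat) (v : bitseq) : bool :=
  nth false v id_index &&
  all (fun i => nth false v i ==> all (fun g => nth false v (rmul i g)) gs) (iota 0 60).

(** In a finite group every element of a generated subgroup is a product of generators without
    inverses; induction on its length. Completeness is thus checked on the result of the search,
    without analysing the search. *)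
Lemma rmul_closed_complete gs v j : all (fun g => g < 60) gs ->
  rmul_closed gs v -> j < 60 -> elt j \in gen_group gs -> nth false v j.
Proof.
move=> gs_lt /andP[v1 /allP vM] lt_j /gen_prodgP[n [c gs_c]] def_j.
rewrite -(eltK lt_j) {}def_j; elim: n c gs_c => [|n IHn] c gs_c.
  by rewrite big_ord0 -elt_id eltK.
rewrite big_ord_recr /=; set s := (\prod_(i < n) _)%g.
have /= v_s: nth false v (idx s) by apply: IHn => i; apply: gs_c.
have: c ord_max \in [seq elt g | g <- gs] by have := gs_c ord_max; rewrite inE.
case/mapP=> g gs_g ->; have lt_g := allP gs_lt g gs_g.
have As: s \in 'Alt_('I_5).
  apply: group_prod => i _; have := gs_c (widen_ord (leqnSn n) i).
  by rewrite inE => /mapP[h /(allP gs_lt) lt_h ->]; apply: elt_Alt.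
have lt_s := idx_lt As.
have /implyP/(_ v_s)/allP/(_ g gs_g) := vM (idx s) (etrans (mem_iota60 _) lt_s).
by rewrite (rmulE lt_s lt_g) (idxK As); apply.
Qed.

(** * Enumeration of the subgroups of A_5 *)

(** Masks stand for subgroups: a generating list is kept only when its mask is new. *)
Definition extend_gens (gss : seq (seq nat)) : seq (seq nat) :=
  let add acc gs := let v := gen_mask gs in
    if v \in unzip2 acc then acc else rcons acc (gs, v) in
  unzip1 (foldl (fun acc gs => foldl (fun acc x => add acc (x :: gs)) acc (iota 0 60))
    [seq (gs, gen_mask gs) | gs <- gss] gss).

(* Every subgroup of A_5 is generated by two elements, so two rounds suffice. *)
Definition subgroup_gens : seq (seq nat) :=
  Eval vm_compute in iter 2 extend_gens [:: [::]].

Definition subgroup_masks : seq bitseq :=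
  Eval vm_compute in [seq gen_mask gs | gs <- subgroup_gens].

(** Certificate for one entry: its mask is exact, and adjoining any element leads to a listed mask.
    For [x :: gs], marked generators suffice in place of a closure test. *)
Definition gens_ok (gs : seq nat) : bool :=
  [&& all (fun g => g < 60) gs, size (gen_mask gs) == 60,
      rmul_closed gs (gen_mask gs) &
      all (fun x => let v := gen_mask (x :: gs) in
        (v \in subgroup_masks) && all (nth false v) (x :: gs)) (iota 0 60)].

Lemma subgroup_gens_ok : all gens_ok subgroup_gens.
Proof. by vm_compute. Qed.

Lemma subgroup_masksE : subgroup_masks = [seq gen_mask gs | gs <- subgroup_gens].
Proof. by vm_compute. Qed.

Lemma gen_maskE gs : gs \in subgroup_gens -> gen_mask gs = group_mask (gen_group gs).
Proof.
move/(allP subgroup_gens_ok)=> /and4P[gs_lt /eqP sz_v v_cl _].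
apply: (@eq_from_nth _ false); first by rewrite sz_v size_mkseq.
move=> j; rewrite sz_v => lt_j; rewrite nth_mkseq //; apply/idP/idP.
  by case/gen_mask_sound.
exact: rmul_closed_complete.
Qed.

(** [hs] is the entry with the same mask as [x :: gs]. The marked generators give one inclusion;
    exactness for [hs] and soundness for [x :: gs] give the other. *)
Lemma gen_group_step gs x : gs \in subgroup_gens -> x < 60 ->
  exists2 hs, hs \in subgroup_gens & gen_group (x :: gs) = gen_group hs.
Proof.
move=> Lgs lt_x; have /and4P[gs_lt _ _ /allP/(_ x)] := allP subgroup_gens_ok gs Lgs.
rewrite mem_iota60 lt_x subgroup_masksE => /(_ isT)/andP[/mapP[hs Lhs def_v] /allP v_gs].
exists hs => //; have /and4P[hs_lt _ _ _] := allP subgroup_gens_ok hs Lhs.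
have hsA: gen_group hs \subset 'Alt_('I_5)%G.
  by rewrite gen_group_subG; apply/allP=> g /(allP hs_lt)/elt_Alt.
apply/group_inj/eqP; rewrite eqEsubset gen_group_subG; apply/andP; split.
  by apply/allP=> g /v_gs; rewrite def_v => /gen_mask_sound[].
apply/subsetP=> s Gs; have As := subsetP hsA s Gs.
rewrite -(idxK As); apply: (proj2 (gen_mask_sound (gs := x :: gs) _ _)); rewrite /= ?lt_x //.
by rewrite def_v gen_maskE // nth_mkseq ?idx_lt // idxK.
Qed.

Lemma subgroups_Alt5 :
  subgroups 'Alt_('I_5) =i [seq gen_group gs | gs <- subgroup_gens].
Proof.
move=> K; rewrite inE; apply/idP/mapP=> [sKA | [gs Lgs ->]]; last first.
  rewrite (gen_group_subG gs 'Alt_('I_5)%G).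
  by have /and4P[/allP gs_lt _ _ _] := allP subgroup_gens_ok gs Lgs; apply/allP=> g /gs_lt/elt_Alt.
(* [K] is generated by the list of all its elements; these are adjoined one at a time, starting from
   the trivial subgroup. *)
have <-: gen_group [seq idx s | s <- enum K] = K.
  apply/group_inj/eqP; rewrite eqEsubset gen_group_subG; apply/andP; split.
    apply/allP=> _ /mapP[s Ks ->]; rewrite mem_enum in Ks.
    by rewrite idxK // (subsetP sKA).
  apply/subsetP=> s Ks; rewrite -(idxK (subsetP sKA s Ks)) mem_gen_group //.
  by rewrite map_f ?mem_enum.
have: all (fun g => g < 60) [seq idx s | s <- enum K].
  by apply/allP=> _ /mapP[s Ks ->]; rewrite mem_enum in Ks; rewrite idx_lt ?(subsetP sKA).
elim: [seq _ | _ <- _] => [|x s IHs] /=; first by exists [::].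
case/andP=> lt_x /IHs[gs Lgs def_gs].
have [hs Lhs def_hs] := gen_group_step Lgs lt_x.
by exists hs; rewrite // -def_hs !gen_group_cons def_gs.
Qed.

Lemma card_gen_group gs : gs \in subgroup_gens ->
  #|gen_group gs| = count id (gen_mask gs).
Proof.
move=> Lgs; have sKA: gen_group gs \in subgroups 'Alt_('I_5) by rewrite subgroups_Alt5 map_f.
rewrite inE in sKA; rewrite (gen_maskE Lgs) count_map.
apply: card_count_enum (iota_uniq 0 60) _ _ => [i j | s /(subsetP sKA) As].
  rewrite !mem_iota60 => lt_i lt_j eq_ij.
  by rewrite -(eltK lt_i) eq_ij (eltK lt_j).
by apply/mapP; exists (idx s); rewrite ?(idxK As) ?mem_iota60 ?idx_lt.
Qed.

(* By Burnside's p^a q^b theorem a subgroup of order 4, 6, 10 or 12 is solvable. *)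
Lemma simple_Alt5_subgroup gs : gs \in subgroup_gens ->
  simple (gen_group gs) = prime (count id (gen_mask gs)) || (count id (gen_mask gs) == 60).
Proof.
move=> Lgs; rewrite -card_gen_group //.
have sKA: gen_group gs \in subgroups 'Alt_('I_5) by rewrite subgroups_Alt5 map_f.
rewrite inE in sKA; apply/idP/orP=> [simK | [prK | /eqP oK]]; last 2 first.
- exact: prime_simple.
- have ->: gen_group gs = 'Alt_('I_5)%G.
    by apply/group_inj/eqP; rewrite eqEcard sKA card_Alt5 oK.
  by rewrite simple_Alt5 ?card_ord.
have: all (fun v => (size (primes (count id v)) <= 2) || (count id v == 60)) subgroup_masks.
  by vm_compute.
rewrite subgroup_masksE all_map => /allP/(_ gs Lgs) /=; rewrite -card_gen_group //.
by case/orP=> [/Burnside_p_a_q_b solK | ->]; [left; apply: simple_sol_prime | right].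
Qed.

(** Distinct masks force distinct subgroups. *)
Lemma uniq_gen_group : uniq [seq gen_group gs | gs <- subgroup_gens].
Proof.
apply: (@map_uniq _ _ group_mask); rewrite -map_comp.
rewrite -(eq_in_map gen_mask _ _).1 => [|gs /gen_maskE //].
by rewrite -subgroup_masksE; vm_compute.
Qed.

Lemma card_subgroups_Alt5 : #|subgroups 'Alt_('I_5)| = 59.
Proof. by rewrite (eq_card subgroups_Alt5) (card_uniqP uniq_gen_group) size_map. Qed.

(** There are 15, 10 and 6 subgroups of orders 2, 3 and 5, and A_5 itself. *)
Lemma card_simple_subgroups_Alt5 : #|simple_subgroups 'Alt_('I_5)%G| = 32.
Proof.
rewrite [LHS](card_set_filter (fun K : {group {perm 'I_5}} => simple K)
  subgroups_Alt5 uniq_gen_group).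
rewrite count_map (eq_in_count simple_Alt5_subgroup).
by vm_compute.
Qed.

End AltFive.

(** * The ratio for the product *)

Local Open Scope ring_scope.

Theorem corollary2p6 (gT hT : finGroupType) (G : {group gT}) (H : {group hT})
    (n m : nat) (p a : 'I_m -> nat)
    (p_inj : injective p)
    (p_prime : forall i, prime (p i))
    (p_gt5 : forall i, (5 < p i)%N)
    (a_ge1 : forall i, (1 <= a i)%N)
    (n_def : n = (\prod_(i < m) p i ^ a i)%N)
    (cycH : cyclic H)
    (cardH : #|H| = n)
    (isoG : (G \isog setX H 'Alt_('I_5))%g) :
  simple_ratio G = (32 + omega n)%:R / (59 * tau n)%:R.
Proof.
have coHA: (coprime #|H| #|'Alt_('I_5)|)%g.
  rewrite cardH n_def card_Alt5.
  elim/big_ind: _ => [|x y cox coy|i _]; rewrite ?coprime1n ?coprimeMl ?cox //.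
  (* The prime divisors of 60 are 2, 3 and 5, none of which exceeds 5. *)
  rewrite coprimeXl // prime_coprime //; apply: contraL (p_gt5 i) => p_dv60.
  have: p i \in primes 60 by rewrite mem_primes p_prime.
  by rewrite !inE => /or3P[] /eqP->.
(* The constant predicate gives the count of all subgroups; [setT_id] later removes the vacuous
   filter. *)
have sX := isog_card_subgroups (Q := xpredT) isoG (fun _ _ _ => erefl).
have sS := isog_card_subgroups isoG (fun K L => @isog_simple _ _ K L).
rewrite /simple_ratio /simple_subgroups sS [X in X%:R / _](card_simple_subgroups_setX coHA).
rewrite card_simple_subgroups_Alt5 card_simple_subgroups_cyclic // cardH addnC.
have setT_id (T : finType) (A : {set T}) : [set x in A | true] = A.
  by apply/setP=> x; rewrite inE andbT.
move: sX; rewrite setT_id => ->; rewrite (card_subgroups_setX xpredT coHA) setT_id.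
by rewrite cardsX card_subgroups_Alt5 card_subgroups_cyclic // cardH mulnC.
Qed.
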